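(* Let $m\ge 1$, let $(R_k,\zeta_k)_{k\in\mathcal K}$ be a complete reference family with a forest structure on $\{1,\dots,m\}$ (as defined in the context), let $(i_1,\dots,i_m)$ be a permutation of $\{1,\dots,m\}$, and let $S_0=\varnothing$, $S_t=\{i_1,\dots,i_t\}$ for $1\le t\le m$. Let $\mathcal P^t\subseteq\mathcal K$, $\mathcal K_t^-\subseteq\mathcal K$ and $(\eta_k^t)_{k\in\mathcal K}$, $0\le t\le m$, be the quantities produced by the recursive procedure described in the context, and let $\mathcal K_t=\{k\in\mathcal K:\exists k'\in\mathcal P^t,\ R_{k'}\subseteq R_k\}$. Then for every $t\in\{0,\dots,m\}$: (1) $\mathcal P^t\in\mathfrak P$, i.e. the sets $R_k$, $k\in\mathcal P^t$, form a partition of $\{1,\dots,m\}$; (2) for all $k\in\mathcal K_t$, $$V^*_{\mathfrak R}(S_t\cap R_k)=\eta_k^t \quad\text{and}\quad V^*_{\mathfrak R}(S_t\cap R_k)=\sum_{k'\in\mathcal P^t,\ R_{k'}\subseteq R_k}\min\left(\zeta_{k'},|S_t\cap R_{k'}|\right);$$ (3) $$V^*_{\mathfrak R}(S_t)=\sum_{k\in\mathcal P^t}\min\left(\zeta_k,|S_t\cap R_k|\right)=\sum_{k\in\mathcal K^1}\eta_k^t .$$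
   Context: **Reference family with forest structure.** Let $(P_n)_{1\le n\le N}$ be a partition of $\{1,\dots,m\}$ into non-empty sets (called atoms or leaves). Let $\mathcal K$ be a non-empty subset of $\{(a,b):1\le a\le b\le N\}$ and for $k=(a,b)\in\mathcal K$ let $R_k=R_{(a,b)}=\bigcup_{a\le n\le b}P_n$. (So the $R_k$ are non-empty and pairwise distinct.) The forest structure assumption is: for all $k,k'\in\mathcal K$, $R_k\cap R_{k'}\in\{R_k,R_{k'},\varnothing\}$. For each $k\in\mathcal K$ let $\zeta_k\in\{0,\dots,|R_k|\}$ be an integer. The reference family is $\mathfrak R=(R_k,\zeta_k)_{k\in\mathcal K}$. It is called complete if $(n,n)\in\mathcal K$ for all $1\le n\le N$ (all atoms are regions of the family). **Depth.** For $k\in\mathcal K$, $\phi(k)=1+|\{k'\in\mathcal K:R_k\subsetneq R_{k'}\}|$; $H=\max_{k\in\mathcal K}\phi(k)$; $\mathcal K^h=\{k\in\mathcal K:\phi(k)=h\}$ for $1\le h\le H$. **Bound.** For $S\subseteq\{1,\dots,m\}$, $V^*_{\mathfrak R}(S)=\max\{|S\cap A|: A\subseteq\{1,\dots,m\},\ |R_k\cap A|\le\zeta_k\ \text{for all }k\in\mathcal K\}$. **Partitions.** $\mathfrak P$ is the set of subsets $Q\subseteq\mathcal K$ such that the $R_k$, $k\in Q$, form a partition of $\{1,\dots,m\}$. **Notation along the path.** For $1\le t\le m$ and $1\le h\le H$, $k^{(t,h)}$ denotes the (unique) element of $\mathcal K^h$ such that $i_t\in R_{k^{(t,h)}}$,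 if it exists; $h_{\max}(t)$ is the largest $h$ such that $k^{(t,h)}$ exists. **Initialization ($t=0$).** $\mathcal K_0^-=\{k\in\mathcal K:\zeta_k=0\}$; $\eta_k^0=0$ for all $k\in\mathcal K$; $\mathcal P^0=E\cup F$, where $E=\{k\in\mathcal K_0^-:\forall k'\in\mathcal K_0^-,\ R_k\subseteq R_{k'}\Rightarrow k'=k\}$ and $F=\{(n,n),\ 1\le n\le N:\forall k\in\mathcal K_0^-,\ R_{(n,n)}\not\subseteq R_k\}$. **Step $t=1,\dots,m$.** - If $i_t\in\bigcup_{\kappa\in\mathcal K_{t-1}^-}R_\kappa$: set $\mathcal P^t=\mathcal P^{t-1}$, $\mathcal K_t^-=\mathcal K_{t-1}^-$, and $\eta_k^t=\eta_k^{t-1}$ for all $k\in\mathcal K$. - Otherwise, for $h=1,2,\dots,h_{\max}(t)$ successively: set $\eta^t_{k^{(t,h)}}=\eta^{t-1}_{k^{(t,h)}}+1$; if $\eta^t_{k^{(t,h)}}<\zeta_{k^{(t,h)}}$, go on to the next $h$; else set $h^f_t=h$, $\mathcal P^t=\left(\mathcal P^{t-1}\setminus\{k\in\mathcal P^{t-1}:R_k\subseteq R_{k^{(t,h^f_t)}}\}\right)\cup\{k^{(t,h^f_t)}\}$, $\mathcal K_t^-=\mathcal K_{t-1}^-\cup\{k^{(t,h^f_t)}\}$, and break the loop over $h$. After the loop: if the loop was broken, set $\eta_k^t=\eta_k^{t-1}$ for all $k\notin\{k^{(t,h)}:1\le h\le h^f_t\}$; if it was not broken, set $\mathcal P^t=\mathcal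 P^{t-1}$, $\mathcal K_t^-=\mathcal K_{t-1}^-$, and $\eta_k^t=\eta_k^{t-1}$ for all $k\notin\{k^{(t,h)}:1\le h\le h_{\max}(t)\}$. *)

(* Defs.v *)
From mathcomp Require Import all_boot all_fingroup.

Set Implicit Arguments.
Unset Strict Implicit.
Unset Printing Implicit Defensive.

(* The ground set {1, ..., m} is 'I_m and the atoms P_1, ..., P_N are indexed
   by 'I_N, so every index is shifted down by one.  Depths h stay in
   1, ..., H, and times t stay in 0, ..., m. *)

Definition region (m N : nat) (P : 'I_N -> {set 'I_m}) (k : 'I_N * 'I_N) :
    {set 'I_m} :=
  \bigcup_(n : 'I_N | (k.1 <= n) && (n <= k.2)) P n.

Record forest_family (m N : nat) := ForestFamily {
  atom : 'I_N -> {set 'I_m};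
  atom_neq0 : forall n, atom n != set0;
  atom_disjoint : forall n n', n != n' -> [disjoint atom n & atom n'];
  atom_cover : \bigcup_n atom n = [set: 'I_m];
  keys : {set 'I_N * 'I_N};
  keys_neq0 : keys != set0;
  keys_le : forall k, k \in keys -> k.1 <= k.2;
  forestP : forall k k', k \in keys -> k' \in keys ->
    region atom k :&: region atom k'
      \in [:: region atom k; region atom k'; set0];
  (* only the values on keys matter *)
  zeta : 'I_N * 'I_N -> nat;
  zeta_le : forall k, k \in keys -> zeta k <= #|region atom k|
}.

Section Family.

Variables (m N : nat) (F : forest_family m N).

Notation key := ('I_N * 'I_N)%type.
Notation K := (keys F).
Notation zeta := (zeta F).

Definition reg (k : key) : {set 'I_m} := region (atom F) k.

Definition complete : Prop := forall n : 'I_N, (n, n) \in K.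

Definition depth (k : key) : nat :=
  1 + #|[set k' in K | reg k \proper reg k']|.

Definition max_depth : nat := \max_(k in K) depth k.

Definition keys_at (h : nat) : {set key} := [set k in K | depth k == h].

(* The empty set is always admissible, so the default value 0 of \max is
   harmless. *)
Definition Vstar (S : {set 'I_m}) : nat :=
  \max_(A : {set 'I_m} | [forall k in K, #|reg k :&: A| <= zeta k])
    #|S :&: A|.

(* reg is injective on K (the atoms are non-empty), so no region is counted
   twice when passing to the set of regions. *)
Definition is_region_partition (Q : {set key}) : Prop :=
  Q \subset K /\ partition [set reg k | k in Q] [set: 'I_m].

Definition key_at (x : 'I_m) (h : nat) : option key :=
  [pick k in keys_at h | x \in reg k].

Definition hmax (x : 'I_m) : nat :=
  \max_(1 <= h < max_depth.+1 | key_at x h != None) h.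

Record state := State {
  part : {set key};       (* \mathcal P^t *)
  saturated : {set key};  (* \mathcal K_t^- *)
  eta : key -> nat        (* \eta^t *)
}.

Definition zero_keys : {set key} := [set k in K | zeta k == 0].

Definition init_part : {set key} :=
  [set k in zero_keys |
     [forall k' in zero_keys, (reg k \subset reg k') ==> (k' == k)]]
  :|: [set (n, n) | n : 'I_N &
         [forall k in zero_keys, ~~ (reg (n, n) \subset reg k)]].

Definition init_state : state := State init_part zero_keys (fun=> 0).

(* The loop over h for the element x: old is the state at time t - 1, hs the
   list of depths still to be visited, and e the current value of eta^t,
   which agrees with eta^(t-1) at all keys not yet visited. *)
Fixpoint loop (x : 'I_m) (old : state) (hs : seq nat) (e : key -> nat) :
    state :=
  if hs is h :: hs' then
    if key_at x h is Some k then
      let e' := [eta e with k |-> (eta old k).+1] in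
      if e' k < zeta k then loop x old hs' e'
      else State (k |: (part old :\: [set k' in part old |
                                        reg k' \subset reg k]))
                 (k |: saturated old) e'
    else loop x old hs' e (* does not occur for h <= hmax x *)
  else State (part old) (saturated old) e.

Definition step (x : 'I_m) (old : state) : state :=
  if x \in \bigcup_(k in saturated old) reg k then old
  else loop x old (iota 1 (hmax x)) (eta old).

(* i_t is i j for the j : 'I_m of value t - 1; insub returns that j whenever
   t <= m. *)
Fixpoint state_at (i : {perm 'I_m}) (t : nat) : state :=
  if t is t'.+1 then
    let old := state_at i t' in
    if insub t' is Some j then step (i j) old else old
  else init_state.

Definition prefix_set (i : {perm 'I_m}) (t : nat) : {set 'I_m} :=
  [set i j | j : 'I_m & j < t].

Definition keys_above (Q : {set key}) : {set key} :=
  [set k in K | [exists k' in Q, reg k' \subset reg k]].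

End Family.

(* Main.v *)
Require Import Defs.
From mathcomp Require Import all_boot all_fingroup.

(** The procedure is greedy, and its correctness comes from one explicit
    optimal set.  Let A collect, along the path, the elements that lie in no
    saturated region at the moment they are met.  Then A is admissible: an
    element is added only when every key region containing it still has room,
    because a region that is full is contained in a saturated one.  So
    [|A :&: R_k|] is a lower bound for the optimal value on [S :&: R_k]
    ([Vstar_ge]).

    For the matching upper bound, let the regions of a set Q of keys partition
    R_k.  Splitting an admissible set along Q bounds the optimal value by the
    sum of the [minn (zeta k') #|S :&: R_k'|] over Q ([Vstar_le]).  On the
    current partition each term equals [|A :&: R_k'|] ([greedy_min]): either k'
    is saturated and A has exactly [zeta k'] elements there, or k' is a leaf
    meeting no saturated region, and then A has lost no element of S in it.
    Hence all the inequalities are equalities ([greedy_Vstar]).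

    Two facts link this to the procedure.  The partition it maintains is a
    function of the saturated keys alone, namely the maximal saturated keys
    together with the leaves that they do not cover ([canonical_part]); this
    makes the partition property a statement about arbitrary sets of keys.  And
    the counter [eta k] equals [|A :&: R_k|] as long as R_k is not strictly
    inside a saturated region, because the loop goes down the chain of regions
    around the new element and stops only at a region that becomes saturated.
    The keys above the current partition are of this kind, and so are all the
    keys of depth 1.  The invariant [greedy] gathers these properties, and
    [greedy_step] propagates it. *)

Set Implicit Arguments.
Unset Strict Implicit.
Unset Printing Implicit Defensive.

(** * Regions and depths in a forest family *)

Section Forest.

Variables (m N : nat) (F : forest_family m N).

Notation key := ('I_N * 'I_N)%type.
Notation K := (keys F).
Notation zeta := (zeta F).
Notation reg := (reg F).

Lemma mem_reg (k : key) x :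
  reflect (exists2 n : 'I_N, k.1 <= n <= k.2 & x \in atom F n) (x \in reg k).
Proof. by apply: (iffP bigcupP) => -[n *]; exists n. Qed.

Lemma atom_inj n n' x : x \in atom F n -> x \in atom F n' -> n = n'.
Proof.
move=> xn xn'; apply/eqP; apply: contraTT xn' => neq.
by rewrite (disjointFr (atom_disjoint F neq) xn).
Qed.

Lemma mem_leaf n x : (x \in reg (n, n)) = (x \in atom F n).
Proof.
apply/mem_reg/idP => [[n' /= n'E]|xn]; last by exists n; rewrite ?leqnn.
by have -> : n' = n by apply/val_inj/eqP; rewrite eqn_leq andbC.
Qed.

(** A region is a union of atoms, so it cannot split a leaf. *)
Lemma leaf_sub n (k : key) x :
  x \in reg (n, n) -> x \in reg k -> reg (n, n) \subset reg k.
Proof.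
rewrite mem_leaf => xn /mem_reg[n' n'k xn'].
rewrite -(atom_inj xn xn') in n'k.
by apply/subsetP => y; rewrite mem_leaf => yn; apply/mem_reg; exists n.
Qed.

Lemma leaf_cover x : exists n, x \in reg (n, n).
Proof.
have /bigcupP[n _ xn] : x \in \bigcup_n atom F n by rewrite atom_cover inE.
by exists n; rewrite mem_leaf.
Qed.

Lemma reg_sub_bounds k k' : k \in K -> reg k \subset reg k' ->
  (k'.1 <= k.1) && (k.2 <= k'.2).
Proof.
move=> kK /subsetP kk'; have le_k := keys_le kK.
have bound (n : 'I_N) : k.1 <= n <= k.2 -> k'.1 <= n <= k'.2.
  move=> nk; have /set0Pn[x xn] := atom_neq0 F n.
  have /mem_reg[n' n'k' xn'] : x \in reg k' by apply/kk'/mem_reg; exists n.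
  by rewrite (atom_inj xn xn').
have /andP[-> _] := bound k.1 (introT andP (conj (leqnn _) le_k)).
by have /andP[_ ->] := bound k.2 (introT andP (conj le_k (leqnn _))).
Qed.

(** Since atoms are non-empty, a region determines the end points of its
    interval of atoms. *)
Lemma reg_inj : {in K &, injective reg}.
Proof.
move=> k k' kK k'K eqR.
have := reg_sub_bounds (k' := k') kK; have := reg_sub_bounds (k' := k) k'K.
rewrite eqR subxx; case: k k' {eqR kK k'K} => [a b] [a' b'] /=.
move=> /(_ isT)/andP[le1 le2] /(_ isT)/andP[le3 le4].
by congr pair; apply/val_inj/anti_leq; rewrite ?le1 ?le2 ?le3 ?le4.
Qed.

Lemma reg_neq0 k : k \in K -> reg k != set0.
Proof.
move=> kK; have /set0Pn[x xn] := atom_neq0 F k.1.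
by apply/set0Pn; exists x; apply/mem_reg; exists k.1; rewrite // leqnn (keys_le kK).
Qed.

(** The forest structure, in the form of a strict/large dichotomy for two
    regions that share a point. *)
Lemma reg_nested k k' x : k \in K -> k' \in K -> x \in reg k -> x \in reg k' ->
  reg k \proper reg k' \/ reg k' \subset reg k.
Proof.
move=> kK k'K xk xk'; rewrite properE; case: (boolP (reg k' \subset reg k)).
  by right.
move=> nk'k; left; rewrite andbT.
have := forestP kK k'K; rewrite !inE -!/(reg _) => /or3P[] /eqP E.
- by rewrite -E subsetIr.
- by rewrite -E subsetIl in nk'k.
- by have := in_set0 x; rewrite -E inE xk xk'.
Qed.

Lemma ltn_depth k k' : k' \in K -> reg k \proper reg k' -> depth F k' < depth F k.
Proof.
move=> k'K kk'; rewrite /depth !add1n ltnS; apply: proper_card.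
apply/properP; split; last by exists k'; rewrite inE k'K //= properxx.
apply/subsetP => d; rewrite !inE => /andP[-> /=]; exact: proper_trans.
Qed.

(** Along the chain of regions containing a point, depth reverses
    inclusion; the loop visits this chain from the outside in. *)
Lemma leq_depth k k' x : k \in K -> k' \in K -> x \in reg k -> x \in reg k' ->
  (depth F k <= depth F k') = (reg k' \subset reg k).
Proof.
move=> kK k'K xk xk'; case: (reg_nested kK k'K xk xk') => [lt|le].
  by rewrite leqNgt ltn_depth //; move: lt => /andP[_ /negPf->].
rewrite le; case: (reg_nested k'K kK xk' xk) => [/ltn_depth-/(_ kK)/ltnW // | le'].
by rewrite (reg_inj kK k'K) ?leqnn //; apply/eqP; rewrite eqEsubset le le'.
Qed.

(** Two keys of the same depth around x are nested, hence equal: the choice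
    made by [key_at] is the only possible one. *)
Lemma key_atP x h k :
  reflect [/\ k \in K, x \in reg k & depth F k = h] (key_at F x h == Some k).
Proof.
rewrite /key_at; case: pickP => [k0|nok]; last first.
  constructor=> -[kK xk dk].
  by have := nok k; rewrite inE kK dk eqxx xk.
rewrite inE -andbA => /and3P[k0K /eqP dk0 xk0].
apply: (iffP eqP) => [[<-] // | [kK xk dk]]; congr Some; apply: reg_inj => //.
apply/eqP; rewrite eqEsubset -(leq_depth kK k0K xk xk0).
by rewrite -(leq_depth k0K kK xk0 xk) dk dk0 leqnn.
Qed.

Lemma depth_hmax x k : k \in K -> x \in reg k -> depth F k \in iota 1 (hmax F x).
Proof.
move=> kK xk; rewrite mem_iota add1n ltnS /=.
have /eqP at_k : key_at F x (depth F k) == Some k by apply/key_atP.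
apply: (@leq_bigmax_seq _ _ _ id); rewrite ?at_k // mem_index_iota ltnS /=.
exact: leq_bigmax_cond.
Qed.

(** * One step of the procedure *)

(** The keys that the loop meets while it runs through the depths in [hs]. *)
Definition visited x (hs : seq nat) k :=
  [&& k \in K, x \in reg k & depth F k \in hs].

(** Either the loop reaches the end of [hs], or it breaks at some key k and
    only the depths up to that of k have been visited.  The counters [e] are
    kept apart from those of [old], because the recursive calls update the
    former and read the latter. *)
Lemma loop_spec x old hs e (st := loop F x old hs e) :
  [/\ forall k, visited x hs k -> (eta old k).+1 < zeta k,
      part st = part old, saturated st = saturated old &
      forall k, eta st k = if visited x hs k then (eta old k).+1 else e k]
  \/ exists k hs1 hs2,
     [/\ hs = hs1 ++ depth F k :: hs2, k \in K, x \in reg k &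
         zeta k <= (eta old k).+1] /\
     [/\ forall k', visited x hs1 k' -> (eta old k').+1 < zeta k',
         part st = k |: (part old :\: [set k' in part old | reg k' \subset reg k]),
         saturated st = k |: saturated old &
         forall k', eta st k' =
           if visited x (rcons hs1 (depth F k)) k' then (eta old k').+1 else e k'].
Proof.
rewrite {}/st; elim: hs e => [|h hs IH] e /=.
  by left; split=> // k; rewrite /visited ?in_nil ?andbF.
have visited_cons hs0 k' :
    visited x (h :: hs0) k' = (key_at F x h == Some k') || visited x hs0 k'.
  rewrite /visited inE; apply/and3P/orP => [[k'K xk' /predU1P[dk'|dk']]|[]].
  - by left; apply/key_atP.
  - by right; rewrite k'K xk'.
  - by case/key_atP=> -> -> ->; rewrite eqxx.
  - by case/and3P=> -> -> ->; rewrite orbT.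
case at_h: (key_at F x h) => [k|]; last first.
  have vE hs0 k' : visited x (h :: hs0) k' = visited x hs0 k'.
    by rewrite visited_cons at_h.
  case: (IH e) => [[lt -> -> etaE]|[k [hs1 [hs2 [[-> kK xk ge] [lt -> -> etaE]]]]]].
    by left; split=> // k; rewrite vE; [apply: lt | apply: etaE].
  right; exists k, (h :: hs1), hs2; split=> //.
  by split=> // k'; rewrite ?rcons_cons vE; [apply: lt | apply: etaE].
have vE hs0 k' : visited x (h :: hs0) k' = (k' == k) || visited x hs0 k'.
  by rewrite visited_cons at_h (inj_eq (@Some_inj _)) eq_sym.
have /eqP/key_atP[kK xk dk] := at_h.
rewrite eqxx; case: ltnP => [lt_k | ge_k]; last first.
  right; exists k, [::], hs; rewrite dk; split=> //; split=> // k'.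
    by rewrite /visited in_nil !andbF.
  by rewrite /= vE /visited in_nil !andbF orbF; case: eqP => // ->.
case: (IH [eta e with k |-> (eta old k).+1])
    => [[lt -> -> etaE]|[k1 [hs1 [hs2 [[-> k1K xk1 ge] [lt -> -> etaE]]]]]].
  left; split=> // k'; rewrite vE; first by case: eqP => [->|_ /lt].
  by rewrite etaE /=; case: eqP => [->|//]; rewrite if_same.
right; exists k1, (h :: hs1), hs2; split=> //; split=> // k'.
  by rewrite vE; case: eqP => [->|_ /lt].
by rewrite rcons_cons vE etaE /=; case: eqP => [->|//]; rewrite if_same.
Qed.

(** The outcome of the loop in terms of inclusion: when it breaks at k, the
    incremented keys are those whose region contains the region of k. *)
Lemma step_spec x old (st := step F x old) :
  x \notin \bigcup_(k in saturated old) reg k ->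
  [/\ forall k, k \in K -> x \in reg k -> (eta old k).+1 < zeta k,
      part st = part old, saturated st = saturated old &
      forall k, k \in K -> eta st k = (x \in reg k) + eta old k]
  \/ exists k,
     [/\ k \in K, x \in reg k & zeta k <= (eta old k).+1] /\
     [/\ forall k', k' \in K -> reg k \proper reg k' -> (eta old k').+1 < zeta k',
         part st = k |: (part old :\: [set k' in part old | reg k' \subset reg k]),
         saturated st = k |: saturated old &
         forall k', k' \in K -> eta st k' = (reg k \subset reg k') + eta old k'].
Proof.
rewrite {}/st /step => /negPf->.
case: (loop_spec x old (iota 1 (hmax F x)) (eta old)).
  case=> [lt -> -> etaE]; left; split=> // k kK => [xk|].
    by apply: lt; rewrite /visited kK xk depth_hmax.
  rewrite etaE /visited kK /=; case: (boolP (x \in reg k)) => //= xk.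
  by rewrite depth_hmax.
case=> k [hs1 [hs2 [[hsE kK xk ge] [lt -> -> etaE]]]]; right; exists k; split=> //.
(* The depths before the break are smaller, and those after it larger, than
   the depth of k. *)
have := iota_ltn_sorted 1 (hmax F x).
rewrite {1}hsE (sorted_pairwise ltn_trans) pairwise_cat => /and3P[lt1 _ /= /andP[lt2 _]].
have mem_hs1 k' : k' \in K -> x \in reg k' ->
    (depth F k' \in rcons hs1 (depth F k)) = (reg k \subset reg k').
  move=> k'K xk'; rewrite -(leq_depth k'K kK xk' xk) mem_rcons inE.
  have /allP gt_k := lt2; have /allrelP lt_k := lt1.
  have := depth_hmax k'K xk'; rewrite hsE mem_cat inE.
  case/or3P => [in1|/eqP->|in2].
  - by rewrite in1 orbT ltnW // lt_k ?mem_head.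
  - by rewrite eqxx leqnn.
  - have lt_kk' := gt_k _ in2; rewrite leqNgt lt_kk' gtn_eqF //=.
    by apply: contraFF (ltnn (depth F k')) => in1; rewrite lt_k // inE in2 orbT.
split=> // k' k'K.
  move=> /[dup]/proper_sub/subsetP/(_ x xk) xk' kk'; apply: lt.
  rewrite /visited k'K xk' /=; have := mem_hs1 k' k'K xk'.
  by rewrite mem_rcons inE ltn_eqF ?ltn_depth //= proper_sub.
rewrite etaE /visited k'K /=; case: (boolP (x \in reg k')) => /= xk'.
  by rewrite mem_hs1 //; case: ifP.
by case: subsetP => // /(_ x xk); rewrite (negPf xk').
Qed.

(** * The partition determined by a set of keys *)

(** For [D = zero_keys F] this is [init_part F]; [canonical_part_setU1] shows
    that each later update of the partition is the effect of enlarging D. *)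
Definition canonical_part (D : {set key}) : {set key} :=
  [set k in D | [forall k' in D, (reg k \subset reg k') ==> (k' == k)]]
  :|: [set (n, n) | n : 'I_N & [forall k in D, ~~ (reg (n, n) \subset reg k)]].

Lemma canonical_partP (D : {set key}) k :
  reflect
    ((k \in D /\ forall k', k' \in D -> reg k \subset reg k' -> k' = k)
     \/ exists2 n, k = (n, n) & forall k', k' \in D -> ~~ (reg k \subset reg k'))
    (k \in canonical_part D).
Proof.
rewrite !inE; apply: (iffP orP) => -[].
- case/andP=> kD /forall_inP kmax; left; split=> // k' k'D kk'.
  by apply/eqP; apply: (implyP (kmax k' k'D)).
- case/imsetP=> n; rewrite inE => /forall_inP nD ->; right; exists n => //.
- case=> kD kmax; left; rewrite kD; apply/forall_inP => k' k'D.
  by apply/implyP => /(kmax _ k'D)->.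
- case=> n -> nD; right; apply/imsetP; exists n => //; rewrite inE.
  exact/forall_inP.
Qed.

Lemma exists_maximal_key (D : {set key}) d0 x : D \subset K -> d0 \in D ->
    x \in reg d0 ->
  exists d, [/\ d \in D, x \in reg d &
    forall k, k \in D -> reg d \subset reg k -> k = d].
Proof.
move=> /subsetP DK d0D xd0; have d0P : (d0 \in D) && (x \in reg d0) by rewrite d0D.
case: (@arg_maxnP _ d0 [pred d in D | x \in reg d] (fun d => #|reg d|) d0P) => d /andP[dD xd] dmax.
exists d; split=> // k kD dk; have xk := subsetP dk x xd.
apply: reg_inj (DK _ kD) (DK _ dD) _; apply/esym/eqP.
by rewrite eqEcard dk; apply: dmax; rewrite /= kD.
Qed.

Lemma depth1P k :
  reflect (k \in K /\ forall k', k' \in K -> ~~ (reg k \proper reg k'))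
          (k \in keys_at F 1).
Proof.
rewrite inE /depth addn_eq1 /= orbF cards_eq0.
apply: (iffP andP) => -[kK maxk]; split=> //.
  move=> k' k'K; apply: contraTN maxk => kk'.
  by apply/set0Pn; exists k'; rewrite inE k'K.
apply/eqP/setP => k'; rewrite !inE.
by case: (boolP (k' \in K)) => //= /maxk/negPf.
Qed.

(** * Upper and lower bounds for the optimal value *)

(** Q may partition more than B, as when B is a region and Q a partition of the
    whole ground set. *)
Lemma region_card_sum (Q : {set key}) (B A : {set 'I_m}) :
    (forall x, x \in B -> exists2 k, k \in Q & (x \in reg k) && (reg k \subset B)) ->
    (forall k k' x, k \in Q -> k' \in Q -> x \in reg k -> x \in reg k' -> k = k') ->
  \sum_(k in Q | reg k \subset B) #|reg k :&: A| = #|B :&: A|.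
Proof.
move=> cov uniq; under eq_bigr do rewrite -sum1dep_card.
rewrite (exchange_big_dep [in B :&: A]) /=.
  rewrite -sum1_card; apply: eq_bigr => x; rewrite inE => /andP[xB xA].
  have [k kQ /andP[xk kB]] := cov x xB.
  rewrite (big_pred1 k) // => k'; apply/idP/eqP => [|->].
    by case/andP=> /andP[k'Q _] /andP[xk' _]; apply: (uniq _ _ x).
  by rewrite kQ kB xk xA.
by move=> k x /andP[_ /subsetP kB]; rewrite inE => /andP[/kB-> ->].
Qed.

Lemma Vstar_ge (S A : {set 'I_m}) :
  (forall k, k \in K -> #|reg k :&: A| <= zeta k) -> #|S :&: A| <= Vstar F S.
Proof.
move=> Aok; apply: (leq_bigmax_cond (F := fun A : {set 'I_m} => #|S :&: A|)).
exact/forall_inP.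
Qed.

(** An admissible set has at most [zeta k] points in each region k of Q, and
    trivially at most as many as S does. *)
Lemma Vstar_le (Q : {set key}) (S B : {set 'I_m}) : Q \subset K ->
    (forall x, x \in B -> exists2 k, k \in Q & (x \in reg k) && (reg k \subset B)) ->
    (forall k k' x, k \in Q -> k' \in Q -> x \in reg k -> x \in reg k' -> k = k') ->
  Vstar F (S :&: B) <=
    \sum_(k in Q | reg k \subset B) minn (zeta k) #|S :&: reg k|.
Proof.
move=> /subsetP QK cov uniq; apply/bigmax_leqP => A /forall_inP Aok.
rewrite (setIC S) -setIA -(region_card_sum _ cov uniq).
apply: leq_sum => k /andP[kQ _]; rewrite leq_min; apply/andP; split.
  by apply: leq_trans (Aok k (QK k kQ)); rewrite setIA setIAC subset_leq_card ?subsetIl.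
by rewrite setIA (setIC S) subset_leq_card ?subsetIl.
Qed.

(** * The canonical partition under completeness *)

Hypothesis F_complete : complete F.

Lemma canonical_part_keys (D : {set key}) : D \subset K -> canonical_part D \subset K.
Proof.
move/subsetP=> DK; apply/subsetP=> k /canonical_partP[[/DK //]|[n -> _]].
exact: F_complete.
Qed.

(** Completeness puts x in some key region; a largest one has depth 1. *)
Lemma exists_root_key x : exists2 k, k \in keys_at F 1 & x \in reg k.
Proof.
have [n xn] := leaf_cover x.
have [k [kK xk kmax]] := exists_maximal_key (subxx K) (F_complete n) xn.
exists k => //; apply/depth1P; split=> // k' k'K; apply/negP => kk'.
by move: (kk'); rewrite (kmax k' k'K (proper_sub kk')) properxx.
Qed.

(** The block around x is the largest region of D around x, or the leaf of x
    if there is none.  It fits in the region of k because nesting leaves only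
    the alternative of k being strictly inside a region of D. *)
Lemma canonical_part_cover (D : {set key}) k x : D \subset K -> k \in K ->
    (forall d, d \in D -> ~~ (reg k \proper reg d)) -> x \in reg k ->
  exists2 k', k' \in canonical_part D & (x \in reg k') && (reg k' \subset reg k).
Proof.
move=> DK kK kmax xk; have DKP := subsetP DK.
case: (pickP [pred d in D | x \in reg d]) => [d0 /andP[d0D xd0] | noD].
  have [d [dD xd dmax]] := exists_maximal_key DK d0D xd0.
  exists d; first by apply/canonical_partP; left.
  rewrite xd; case: (reg_nested kK (DKP d dD) xk xd) => // lt.
  by have := kmax d dD; rewrite lt.
have [n xn] := leaf_cover x; exists (n, n); last by rewrite xn (leaf_sub xn).
apply/canonical_partP; right; exists n => // k' k'D.
by apply: contraFN (noD k') => /subsetP nk' /=; rewrite k'D nk'.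
Qed.

Lemma canonical_part_coverT (D : {set key}) x : D \subset K ->
  exists2 k, k \in canonical_part D & x \in reg k.
Proof.
move=> DK; have [k /depth1P[kK kmax] xk] := exists_root_key x.
have [|k' k'P /andP[xk' _]] := canonical_part_cover DK kK _ xk; last by exists k'.
by move=> d /(subsetP DK); apply: kmax.
Qed.

Lemma canonical_part_uniq (D : {set key}) k k' x : D \subset K ->
  k \in canonical_part D -> k' \in canonical_part D ->
  x \in reg k -> x \in reg k' -> k = k'.
Proof.
move=> /subsetP DK; have sym d n : d \in D ->
    (forall d', d' \in D -> ~~ (reg (n, n) \subset reg d')) ->
    x \in reg d -> x \in reg (n, n) -> d = (n, n).
  by move=> dD nD xd xn; have := nD d dD; rewrite (leaf_sub xn xd).
case/canonical_partP=> [[kD kmax]|[n -> nD]];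
  case/canonical_partP=> [[k'D k'max]|[n' -> n'D]] xk xk'.
- case: (reg_nested (DK _ kD) (DK _ k'D) xk xk') => [/proper_sub/(kmax k' k'D)//|].
  exact: k'max.
- exact: sym.
- exact/esym/sym.
- by rewrite !mem_leaf in xk xk'; rewrite (atom_inj xk xk').
Qed.

Lemma canonical_part_partition (D : {set key}) : D \subset K ->
  is_region_partition F (canonical_part D).
Proof.
move=> DK; split; first exact: canonical_part_keys.
have PK := subsetP (canonical_part_keys DK).
apply/and3P; split.
- rewrite eqEsubset subsetT; apply/subsetP => x _; apply/bigcupP => /=.
  have [k kP xk] := canonical_part_coverT x DK.
  by exists (reg k) => //; apply: imset_f.
- apply/trivIsetP => _ _ /imsetP[k kP ->] /imsetP[k' k'P ->] neq.
  rewrite -setI_eq0; apply: contraNT neq => /set0Pn[x].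
  by rewrite inE => /andP[xk /(canonical_part_uniq DK kP k'P xk)->].
- by apply/imsetP => -[k /PK/reg_neq0] /[swap] <-; rewrite eqxx.
Qed.

(** Because x is in the region of k and in no region of D, k is not covered
    by D, so it becomes a maximal key; it removes exactly the blocks inside
    its region. *)
Lemma canonical_part_setU1 (D : {set key}) k x :
    x \in reg k -> x \notin \bigcup_(d in D) reg d ->
  canonical_part (k |: D) =
    k |: (canonical_part D :\: [set k' in canonical_part D | reg k' \subset reg k]).
Proof.
move=> xk xD; have kD d : d \in D -> ~~ (reg k \subset reg d).
  by move=> dD; apply: contra xD => /subsetP kd; apply/bigcupP; exists d; auto.
apply/setP=> k1; rewrite in_setU1 in_setD inE.
apply/canonical_partP/predU1P => [[[k1U k1max]|[n -> nU]]|].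
- have [->|neq] := eqVneq k1 k; [by left | right].
  have k1D : k1 \in D by move: k1U; rewrite in_setU1 (negPf neq).
  have k1P : k1 \in canonical_part D.
    apply/canonical_partP; left; split=> // k' k'D.
    by apply: k1max; rewrite in_setU1 k'D orbT.
  rewrite k1P andbT /=; apply: contra neq => /(k1max k (setU11 _ _))->; exact: eqxx.
- right; rewrite (negPf (nU _ (setU11 _ _))) andbF /=.
  apply/canonical_partP; right; exists n => // k' k'D.
  by apply: nU; rewrite in_setU1 k'D orbT.
case=> [->|/andP[nk1 k1P]].
  left; split=> [|k']; first exact: setU11.
  by case/setU1P=> [-> //|/kD/negPf->].
rewrite k1P /= in nk1.
case/canonical_partP: k1P => [[k1D k1max]|[n k1E nD]]; [left|right].
  split=> [|k']; first by rewrite in_setU1 k1D orbT.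
  by case/setU1P=> [->|/k1max //]; rewrite (negPf nk1).
by exists n => // k' /setU1P[->|/nD].
Qed.

(** * The greedy set and its invariant *)

(** S stands for the elements met so far.  The range of k is wider in
    [greedy_eta] than in [greedy_lt]: a saturated region is full, but the
    counter of a maximal one is still exact. *)
Record greedy (st : state N) (S A : {set 'I_m}) : Prop := Greedy {
  greedy_part : part st = canonical_part (saturated st);
  greedy_keys : saturated st \subset K;
  greedy_sub : A \subset S;
  greedy_skip : S :\: A \subset \bigcup_(d in saturated st) reg d;
  greedy_sat : forall k, k \in saturated st -> #|reg k :&: A| = zeta k;
  greedy_le : forall k, k \in K -> #|reg k :&: A| <= zeta k;
  greedy_lt : forall k, k \in K ->
    (forall d, d \in saturated st -> ~~ (reg k \subset reg d)) ->
    #|reg k :&: A| < zeta k;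
  greedy_eta : forall k, k \in K ->
    (forall d, d \in saturated st -> ~~ (reg k \proper reg d)) ->
    eta st k = #|reg k :&: A|
}.

Lemma greedy_init : greedy (init_state F) set0 set0.
Proof.
split=> //=.
- by apply/subsetP => k; rewrite inE => /andP[].
- by rewrite setD0 sub0set.
- by move=> k; rewrite inE setI0 cards0 => /andP[_ /eqP].
- by move=> k kK; rewrite setI0 cards0.
- move=> k kK nk; rewrite setI0 cards0 lt0n; apply/negP => zk.
  by have := nk k; rewrite inE kK zk subxx => /(_ isT).
- by move=> k kK _; rewrite setI0 cards0.
Qed.

(** The greedy set gains x exactly when x lies in no saturated region.  In that
    case [greedy_lt] gives room for x in every region containing it, and a
    break at k happens exactly when x fills the region of k. *)
Lemma greedy_step st S A x : greedy st S A -> x \notin S ->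
  exists A', greedy (step F x st) (x |: S) A'.
Proof.
case=> partE satK AS skip satE le lt etaE xS.
case: (boolP (x \in \bigcup_(d in saturated st) reg d)) => [xc|xc].
  (* Every element skipped by A lies in a saturated region, and so does x. *)
  exists A; rewrite /step xc; split=> //.
    exact: subset_trans AS (subsetUr _ _).
  by rewrite setDUl subUset skip andbT; apply/subsetP => y /setDP[/set1P->].
exists (x |: A).
have xA : x \notin A by apply: contra xS; apply: (subsetP AS).
have cardU k : #|reg k :&: (x |: A)| = (x \in reg k) + #|reg k :&: A|.
  rewrite setIUr; case: (boolP (x \in reg k)) => xk.
    have /setIidPr-> : [set x] \subset reg k by rewrite sub1set.
    by rewrite cardsU1 inE (negPf xA) andbF.
  rewrite (_ : reg k :&: [set x] = set0) ?set0U //.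
  by apply/setP => y; rewrite !inE; apply: contraNF xk => /andP[yk /eqP<-].
have xd d : d \in saturated st -> x \notin reg d.
  by move=> dD; apply: contra xc => xd; apply/bigcupP; exists d.
have ltx k : k \in K -> x \in reg k -> #|reg k :&: A| < zeta k.
  move=> kK xk; apply: lt => // d dD; apply/negP => /subsetP/(_ x xk) xd'.
  by have := xd d dD; rewrite xd'.
have etax k : k \in K -> x \in reg k -> eta st k = #|reg k :&: A|.
  move=> kK xk; apply: etaE => // d dD; apply/negP => /proper_sub/subsetP/(_ x xk) xd'.
  by have := xd d dD; rewrite xd'.
have AS' : x |: A \subset x |: S by apply: setUS.
have skip' (D : {set key}) : saturated st \subset D ->
    (x |: S) :\: (x |: A) \subset \bigcup_(d in D) reg d.
  move=> sD; apply/subsetP=> y; rewrite !inE negb_or.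
  case/andP=> /andP[/negPf-> yA] /= yS.
  have /(subsetP skip)/bigcupP[d dD yd] : y \in S :\: A by rewrite inE yA.
  by apply/bigcupP; exists d => //; apply: (subsetP sD).
have le' k : k \in K -> #|reg k :&: (x |: A)| <= zeta k.
  move=> kK; rewrite cardU; case: (boolP (x \in reg k)) => xk; last exact: le.
  exact: ltx.
case: (step_spec xc) => [[ltz partE' satE' etaE']|].
  split; rewrite ?partE' ?satE' //.
  - exact: (skip' _ (subxx _)).
  - by move=> k kD; rewrite cardU (negPf (xd k kD)) satE.
  - move=> k kK nk; rewrite cardU; case: (boolP (x \in reg k)) => xk; last exact: lt.
    by rewrite add1n -(etax k kK xk) ltz.
  - by move=> k kK nk; rewrite cardU etaE' // etaE.
case=> k [[kK xk ge] [ltz partE' satE' etaE']].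
have sD : saturated st \subset k |: saturated st by apply: subsetUr.
split; rewrite ?satE' //.
- by rewrite partE' partE -(canonical_part_setU1 xk xc).
- by rewrite subUset satK sub1set kK.
- exact: (skip' _ sD).
- move=> d /setU1P[->|dD]; last by rewrite cardU (negPf (xd d dD)) satE.
  by apply/eqP; rewrite eqn_leq le' //= cardU xk add1n -etax.
(* Around x, a region not inside that of k strictly contains it, so the loop
   went through it without saturating it. *)
- move=> k' k'K nk'; have nk'D d : d \in saturated st -> ~~ (reg k' \subset reg d).
    by move=> dD; apply/nk'/(subsetP sD).
  rewrite cardU; case: (boolP (x \in reg k')) => xk'; last exact: lt.
  rewrite add1n -etax // ltz //; case: (reg_nested kK k'K xk xk') => // k'k.
  by have := nk' k (setU11 _ _); rewrite k'k.
(* The loop increments the regions containing that of k, while A grows in the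
   regions containing x; these differ only by regions strictly inside k. *)
- move=> k' k'K nk'; rewrite cardU etaE' // etaE //; last first.
    by move=> d dD; apply/nk'/(subsetP sD).
  congr (nat_of_bool _ + _); apply/idP/idP => [/subsetP/(_ x xk) // | xk'].
  case: (reg_nested k'K kK xk' xk) => // k'k.
  by have := nk' k (setU11 _ _); rewrite k'k.
Qed.

Lemma prefix_set0 (i : {perm 'I_m}) : prefix_set i 0 = set0.
Proof. by apply/setP => x; rewrite in_set0; apply/imsetP => -[j]; rewrite inE. Qed.

Lemma prefix_setS (i : {perm 'I_m}) (j : 'I_m) :
  prefix_set i j.+1 = i j |: prefix_set i j.
Proof.
rewrite /prefix_set -imsetU1; congr (imset i (mem (pred_of_set _))); apply/setP => j'.
by rewrite !inE ltnS leq_eqVlt.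
Qed.

Lemma greedy_state_at (i : {perm 'I_m}) t : t <= m ->
  exists A, greedy (state_at F i t) (prefix_set i t) A.
Proof.
elim: t => [_|t IH lt_tm]; first by exists set0; rewrite prefix_set0; apply: greedy_init.
have [A gA] := IH (ltnW lt_tm).
rewrite /= insubT (prefix_setS i (Ordinal lt_tm)); apply: greedy_step gA _.
by rewrite mem_imset ?inE ?ltnn //; apply: perm_inj.
Qed.

(** A saturated block is full; an unsaturated leaf meets no saturated region,
    so that A contains all of S inside it. *)
Lemma greedy_min st S A k : greedy st S A -> k \in part st ->
  minn (zeta k) #|S :&: reg k| = #|reg k :&: A|.
Proof.
case=> -> satK AS /subsetP skip satE le lt etaE kP.
have cardS : #|reg k :&: A| <= #|S :&: reg k|.
  by rewrite setIC subset_leq_card // setSI.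
case/canonical_partP: (kP) => [[kD _]|[n kE nD]].
  by rewrite -satE //; apply/minn_idPl.
suff -> : S :&: reg k = reg k :&: A.
  by apply/minn_idPr/le/(subsetP (canonical_part_keys satK)).
rewrite setIC; apply/eqP; rewrite eqEsubset andbC setIS //=.
apply/subsetP=> y; rewrite !inE => /andP[yk yS]; rewrite yk /=.
apply: contraT => yA; have /skip/bigcupP[d dD yd] : y \in S :\: A by rewrite inE yA.
by have := nD d dD; rewrite {1}kE (leaf_sub (n := n) _ yd) // -kE.
Qed.

(** Both bounds for the optimal value meet at the number of points of A. *)
Lemma greedy_Vstar st S A (B : {set 'I_m}) : greedy st S A ->
    (forall x, x \in B ->
       exists2 k, k \in part st & (x \in reg k) && (reg k \subset B)) ->
  Vstar F (S :&: B) = #|B :&: A| /\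
  \sum_(k in part st | reg k \subset B) minn (zeta k) #|S :&: reg k| = #|B :&: A|.
Proof.
move=> gA cov; have satK := greedy_keys gA.
have uniq k k' x : k \in part st -> k' \in part st ->
    x \in reg k -> x \in reg k' -> k = k'.
  by rewrite (greedy_part gA); apply: canonical_part_uniq.
have sumE : \sum_(k in part st | reg k \subset B) minn (zeta k) #|S :&: reg k|
    = #|B :&: A|.
  rewrite -(region_card_sum A cov uniq).
  by apply: eq_bigr => k /andP[kP _]; rewrite (greedy_min gA).
split=> //; apply/eqP; rewrite eqn_leq -{1}sumE Vstar_le //=.
  have := Vstar_ge (S :&: B) (greedy_le gA).
  by rewrite (setIC S) -setIA (setIidPr (greedy_sub gA)).
by rewrite (greedy_part gA) canonical_part_keys.
Qed.

End Forest.

Theorem theorem3p1 (m N : nat) (F : forest_family m N) (i : {perm 'I_m})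
    (t : nat) (m_gt0 : 1 <= m) (F_complete : complete F) (t_le_m : t <= m) :
  let S := prefix_set i t in
  let P := part (state_at F i t) in
  let eta_t := eta (state_at F i t) in
  [/\ is_region_partition F P,
      forall k, k \in keys_above F P ->
        Vstar F (S :&: reg F k) = eta_t k /\
        Vstar F (S :&: reg F k) =
          \sum_(k' in P | reg F k' \subset reg F k)
             minn (zeta F k') #|S :&: reg F k'|
    & Vstar F S = \sum_(k in P) minn (zeta F k) #|S :&: reg F k| /\
      \sum_(k in P) minn (zeta F k) #|S :&: reg F k| =
        \sum_(k in keys_at F 1) eta_t k].
Proof.
move=> S P eta_t; have [A gA] := greedy_state_at F i t_le_m.
have satK := greedy_keys gA; have PE := greedy_part gA.
rewrite -/S -/P in gA PE *.
split; first by rewrite PE; apply: canonical_part_partition.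
  move=> k; rewrite inE => /andP[kK /exists_inP[k' k'P k'k]].
  (* A key above the partition is not strictly inside a saturated region, since
     a block below it would be neither maximal nor uncovered. *)
  have kmax d : d \in saturated (state_at F i t) -> ~~ (reg F k \proper reg F d).
    move=> dD; apply/negP => kd; have k'd := sub_proper_trans k'k kd.
    move: k'P; rewrite PE => /canonical_partP[[_ k'max]|[n _ nD]].
      by move: (k'd); rewrite (k'max d dD (proper_sub k'd)) properxx.
    by have := nD d dD; rewrite proper_sub.
  have [] := greedy_Vstar F_complete gA (B := reg F k).
    by move=> x; rewrite -/P PE; apply: (canonical_part_cover satK kK kmax).
  by move=> -> ->; rewrite /eta_t (greedy_eta gA).
have [] := greedy_Vstar F_complete gA (B := setT).
  move=> x _; rewrite -/P PE; have [k kP xk] := canonical_part_coverT F_complete x satK.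
  by exists k; rewrite // xk subsetT.
rewrite setIT; under eq_bigl do rewrite subsetT andbT.
rewrite -/P => -> ->; split=> //.
rewrite -(region_card_sum (F := F) (Q := keys_at F 1)).
- under eq_bigl do rewrite subsetT andbT.
  apply: eq_bigr => k /depth1P[kK kmax]; rewrite /eta_t (greedy_eta gA) // => d dD.
  exact/kmax/(subsetP satK).
- move=> x _; have [k kP xk] := exists_root_key F_complete x.
  by exists k; rewrite // xk subsetT.
- move=> k k' x; rewrite !inE => /andP[kK /eqP dk] /andP[k'K /eqP dk'] xk xk'.
  apply: Some_inj; transitivity (key_at F x 1); last exact/eqP/key_atP.
  exact/esym/eqP/key_atP.
Qed.
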